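(* Suppose $\nu^\tau={\stackrel{*}{\nu}}{}^\tau+\widetilde\nu{}^\tau i$, $\nu^{s+\tau}={\stackrel{*}{\nu}}{}^\tau-\widetilde\nu{}^\tau i$, $\tau=1,\ldots,s$, $s\le m/2$, and $\nu^{2s+1}={\stackrel{*}{\nu}}{}^{2s+1}+\widetilde\nu{}^{2s+1}i$ are common complex eigenvectors of the matrices $A_j$ corresponding to the eigenvalues $\lambda_\tau^j={\stackrel{*}{\lambda}}{}_\tau^j+\widetilde\lambda{}_\tau^ji$, $\lambda_{s+\tau}^j={\stackrel{*}{\lambda}}{}_\tau^j-\widetilde\lambda{}_\tau^ji$, $\tau=1,\ldots,s$, $\lambda_{2s+1}^j={\stackrel{*}{\lambda}}{}_{2s+1}^j+\widetilde\lambda{}_{2s+1}^ji$, $j=1,\ldots,m$, respectively. Let $\nu^\theta$ be common real eigenvectors of the $A_j$ corresponding to the eigenvalues $\lambda_\theta^j$, $j=1,\ldots,m$, $\theta=2s+2,\ldots,m+1$, respectively. Then the completely solvable system $dx=A(x)\,dt$ has the autonomous first integrals $$F_1\colon x\to\prod_{k=1}^s\bigl(P_k(x)\bigr)^{{\stackrel{*}{h}}_k+{\stackrel{*}{h}}_{s+k}}\exp\bigl(-2(\widetilde h_k-\widetilde h_{s+k})\varphi_k(x)\bigr)\cdot\bigl(P_{2s+1}(x)\bigr)^{{\stackrel{*}{h}}_{2s+1}}\exp\bigl(-2\widetilde h_{2s+1}\varphi_{2s+1}(x)\bigr)\prod_{\theta=2s+2}^{m+1}\bigl(\nu^\theta x\bigr)^{2{\stackrel{*}{h}}_\theta}$$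 and $$F_2\colon x\to\prod_{k=1}^s\bigl(P_k(x)\bigr)^{\widetilde h_k+\widetilde h_{s+k}}\exp\bigl(2({\stackrel{*}{h}}_k-{\stackrel{*}{h}}_{s+k})\varphi_k(x)\bigr)\cdot\bigl(P_{2s+1}(x)\bigr)^{\widetilde h_{2s+1}}\exp\bigl(2{\stackrel{*}{h}}_{2s+1}\varphi_{2s+1}(x)\bigr)\prod_{\theta=2s+2}^{m+1}\bigl(\nu^\theta x\bigr)^{2\widetilde h_\theta}$$ for all $x\in\mathscr X$, where $\mathscr X\subset{\rm D}(F_1)\cap{\rm D}(F_2)$ is a domain, $$P_k(x)=({\stackrel{*}{\nu}}{}^kx)^2+(\widetilde\nu{}^kx)^2,\quad\varphi_k(x)=\arctan\frac{\widetilde\nu{}^kx}{{\stackrel{*}{\nu}}{}^kx},\quad k=1,\ldots,s,2s+1,$$ and $h_k={\stackrel{*}{h}}_k+\widetilde h_ki$, $k=1,\ldots,m+1$, is a nontrivial (complex) solution of $\sum_{k=1}^{m+1}\lambda_k^jh_k=0$, $j=1,\ldots,m$.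
   Context: Let $x=(x_1,\ldots,x_n)\in\mathbb R^n$, $t=(t_1,\ldots,t_m)\in\mathbb R^m$. Consider the linear autonomous system of equations in total differentials $dx=A(x)\,dt$, where $A(x)=\|a_{ij}(x)\|$ is $n\times m$ with $a_{ij}(x)=\sum_{\xi=1}^na_{ij\xi}x_\xi$, $a_{ij\xi}\in\mathbb R$. Put $\mathfrak p_j(x)=\sum_{i=1}^na_{ij}(x)\partial_{x_i}$, $j=1,\ldots,m$. The system is assumed completely solvable: $[\mathfrak p_j,\mathfrak p_\zeta]=0$ on $\mathbb R^n$ for all $j,\zeta$. Let $A_j$ be the real $n\times n$ matrix whose entry in row $i$ and column $\xi$ is $a_{\xi ji}$ (so the system is $dx=\sum_jA_j^{T}x\,dt_j$); complete solvability is equivalent to $A_jA_\zeta=A_\zeta A_j$ for all $j,\zeta$. For a vector $\nu$, $\nu x=\sum_{i=1}^n\nu_ix_i$. A star over a symbol denotes the real part and a tilde the imaginary part. A continuously differentiable function $F$ on a domain $\mathscr X\subset\mathbb R^n$ is an autonomous first integral if $\mathfrak p_jF=0$ on $\mathscr X$, $j=1,\ldots,m$. ${\rm D}(F)$ denotes the set where $F$ is defined and continuously differentiable. *)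

(* Defs.v *)
From HB Require Import structures.
From mathcomp Require Import all_boot all_order all_algebra.
From mathcomp Require Import complex.
From mathcomp Require Import all_classical all_reals all_analysis.

Set Implicit Arguments.
Unset Strict Implicit.
Unset Printing Implicit Defensive.

Import Order.TTheory GRing.Theory Num.Theory.
Import numFieldNormedType.Exports.

Local Open Scope classical_set_scope.
Local Open Scope ring_scope.

(* The real power [b ^ e] on its natural domain: any exponent for [b > 0]
   (this is [powR]), nonnegative exponents for [b = 0] (with [0 ^ 0 = 1]), and,
   for [b < 0], the exponents that are fractions with an odd denominator, in
   particular all integers. [rpow] is total; outside [rpow_defined] its value
   has no meaning. *)
Section real_power.
Variable R : realType.

Definition frac_odd_den (e : R) : Prop :=
  exists (p : int) (q : nat), odd q /\ e = p%:~R / q%:R.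

Definition frac_odd_odd (e : R) : Prop :=
  exists (p : int) (q : nat), [/\ odd `|p|%N, odd q & e = p%:~R / q%:R].

Definition rpow_defined (b e : R) : Prop :=
  [\/ 0 < b, b = 0 /\ 0 <= e | b < 0 /\ frac_odd_den e].

Definition rpow (b e : R) : R :=
  if (b < 0) && `[< frac_odd_odd e >] then - (`|b| `^ e) else `|b| `^ e.

End real_power.

Section smooth_functions.
Variables (R : realType) (n : nat).
Implicit Types (F : 'cV[R]_n -> R) (X : set 'cV[R]_n).

Definition partial (i : 'I_n) F (x : 'cV[R]_n) : R := 'D_(delta_mx i 0) F x.

(* Meant to be required at all points of an open set. *)
Definition C1_at F (x : 'cV[R]_n) : Prop :=
  forall i : 'I_n, derivable F x (delta_mx i 0)
                   /\ {for x, continuous (partial i F)}.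

Definition C1_on X F : Prop := forall x, X x -> C1_at F x.

Definition C2 F : Prop := C1_on setT F /\ forall i, C1_on setT (partial i F).

(* D(F), for the partial function equal to [F] on [dom]: the largest open set
   on which it is defined and continuously differentiable. *)
Definition C1_domain (dom : set 'cV[R]_n) F : set 'cV[R]_n :=
  [set x | \forall y \near x, dom y /\ C1_at F y].

Definition is_domain X : Prop := [/\ open X, connected X & X !=set0].

End smooth_functions.

Section linear_system.
Variables (R : realType) (n m : nat).
(* [a i j xi] is the coefficient a_{ij xi}. *)
Variable a : 'I_n -> 'I_m -> 'I_n -> R.

Definition sysA (x : 'cV[R]_n) : 'M[R]_(n, m) :=
  \matrix_(i, j) \sum_(xi < n) a i j xi * x xi 0.

Definition fp (j : 'I_m) (F : 'cV[R]_n -> R) (x : 'cV[R]_n) : R :=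
  \sum_(i < n) sysA x i j * partial i F x.

(* [p_j, p_zeta] = 0 on R^n, as differential operators. *)
Definition completely_solvable : Prop :=
  forall (j zeta : 'I_m) (F : 'cV[R]_n -> R), C2 F ->
    forall x, fp j (fp zeta F) x - fp zeta (fp j F) x = 0.

(* Row and column are exchanged: entry (i, xi) is a_{xi j i}. *)
Definition Amx (j : 'I_m) : 'M[R]_n := \matrix_(i, xi) a xi j i.

Definition first_integral (X : set 'cV[R]_n) (F : 'cV[R]_n -> R) : Prop :=
  [/\ is_domain X, C1_on X F & forall j x, X x -> fp j F x = 0].

Definition common_eigenvector_of (v : 'cV[R[i]]_n) (l : 'I_m -> R[i]) : Prop :=
  v != 0 /\ forall j, map_mx (real_complex R) (Amx j) *m v = l j *: v.

End linear_system.

(* The families [nu] and [h] are indexed from 1, as in the formulas; only the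
   indices 1, ..., m + 1 matter. *)
Section functions.
Variables (R : realType) (n m s : nat).
Variables (nu : nat -> 'cV[R[i]]_n) (h : nat -> R[i]).
Implicit Types x : 'cV[R]_n.

Definition dotp (v x : 'cV[R]_n) : R := \sum_(i < n) v i 0 * x i 0.

Definition vRe (v : 'cV[R[i]]_n) : 'cV[R]_n := map_mx (@complex.Re R) v.
Definition vIm (v : 'cV[R[i]]_n) : 'cV[R]_n := map_mx (@complex.Im R) v.

Local Notation hRe k := (complex.Re (h k)).
Local Notation hIm k := (complex.Im (h k)).

Definition P (k : nat) x : R :=
  dotp (vRe (nu k)) x ^+ 2 + dotp (vIm (nu k)) x ^+ 2.

Definition phi (k : nat) x : R :=
  atan (dotp (vIm (nu k)) x / dotp (vRe (nu k)) x).

Definition phi_defined (k : nat) x : Prop := dotp (vRe (nu k)) x != 0.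

Definition F1 x : R :=
  (\prod_(1 <= k < s.+1)
     (rpow (P k x) (hRe k + hRe (s + k)%N)
      * expR (- 2 * (hIm k - hIm (s + k)%N) * phi k x)))
  * (rpow (P (2 * s).+1 x) (hRe (2 * s).+1)
     * expR (- 2 * hIm (2 * s).+1 * phi (2 * s).+1 x))
  * \prod_((2 * s).+2 <= k < m.+2) rpow (dotp (vRe (nu k)) x) (2 * hRe k).

Definition F2 x : R :=
  (\prod_(1 <= k < s.+1)
     (rpow (P k x) (hIm k + hIm (s + k)%N)
      * expR (2 * (hRe k - hRe (s + k)%N) * phi k x)))
  * (rpow (P (2 * s).+1 x) (hIm (2 * s).+1)
     * expR (2 * hRe (2 * s).+1 * phi (2 * s).+1 x))
  * \prod_((2 * s).+2 <= k < m.+2) rpow (dotp (vRe (nu k)) x) (2 * hIm k).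

Definition F1_defined : set 'cV[R]_n := [set x |
  [/\ forall k, (1 <= k <= s)%N ->
        phi_defined k x /\ rpow_defined (P k x) (hRe k + hRe (s + k)%N),
      phi_defined (2 * s).+1 x
        /\ rpow_defined (P (2 * s).+1 x) (hRe (2 * s).+1)
    & forall k, ((2 * s).+2 <= k <= m.+1)%N ->
        rpow_defined (dotp (vRe (nu k)) x) (2 * hRe k)]].

Definition F2_defined : set 'cV[R]_n := [set x |
  [/\ forall k, (1 <= k <= s)%N ->
        phi_defined k x /\ rpow_defined (P k x) (hIm k + hIm (s + k)%N),
      phi_defined (2 * s).+1 x
        /\ rpow_defined (P (2 * s).+1 x) (hIm (2 * s).+1)
    & forall k, ((2 * s).+2 <= k <= m.+1)%N ->
        rpow_defined (dotp (vRe (nu k)) x) (2 * hIm k)]].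

End functions.

(* Main.v *)
Require Import Defs.
From HB Require Import structures.
From mathcomp Require Import all_boot all_order all_algebra.
From mathcomp Require Import complex ring zify.
From mathcomp Require Import all_classical all_reals all_analysis.
Import Order.TTheory GRing.Theory Num.Theory.
Import numFieldNormedType.Exports.
Local Open Scope classical_set_scope.
Local Open Scope ring_scope.
Set Implicit Arguments.
Unset Strict Implicit.
Unset Printing Implicit Defensive.

(** Write w_k for the complex linear form nu^k x. A common eigenvector of the
A_j is exactly a linear form with p_j w_k = lambda_k^j w_k. Where the real part
of w_k does not vanish, P_k = |w_k|^2 and phi_k is, up to a locally constant term, the argument
of w_k, so that p_j (ln P_k) = 2 Re lambda_k^j and p_j phi_k = Im lambda_k^j.
The forms of index s + k are the conjugates of those of index k, and the
eigenvalues of the real forms are real; hence F_1 is, locally and up to a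
constant factor, exp (2 Re (sum_k h_k ln w_k)), and
    p_j F_1 = F_1 * 2 Re (sum_k lambda_k^j h_k) = 0.
Since multiplying h by -i turns F_1 into F_2 and preserves the linear system on
h, only F_1 has to be treated ([F1_mulNi]).

This computation ([fp_F1_eq0_generic]) needs every linear form nu^theta x to be
nonzero, and the domain of F_1 may meet the hyperplanes nu^theta x = 0, where
the powers need not be differentiable one by one. There the identity follows by
density and continuity: p_j F_1 is continuous where F_1 is continuously
differentiable, and any point x is the limit of x + t v as t tends to 0, with v
chosen outside finitely many hyperplanes so that x + t v avoids all of them for
small nonzero t ([near_line_avoid], [avoid_hyperplanes], [fp_F1_eq0]).

The computation is organised around logarithmic derivatives
([log_derivative]), which add up over the factors of F_1. *)

(** * The pairing of vectors and the hyperplanes it defines *)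

Section DotProduct.
Variables (R : realType) (n : nat).
Implicit Types (u v x y : 'cV[R]_n) (c : R).

Lemma dotpDl u v x : dotp (u + v) x = dotp u x + dotp v x.
Proof.
by rewrite -big_split; apply: eq_bigr => i _; rewrite mxE mulrDl.
Qed.

Lemma dotpDr u x y : dotp u (x + y) = dotp u x + dotp u y.
Proof.
by rewrite -big_split; apply: eq_bigr => i _; rewrite mxE mulrDr.
Qed.

Lemma dotpZl c u x : dotp (c *: u) x = c * dotp u x.
Proof. by rewrite mulr_sumr; apply: eq_bigr => i _; rewrite mxE mulrA. Qed.

Lemma dotpZr c u x : dotp u (c *: x) = c * dotp u x.
Proof. by rewrite mulr_sumr; apply: eq_bigr => i _; rewrite mxE mulrCA. Qed.

Lemma dotpBl u v x : dotp (u - v) x = dotp u x - dotp v x.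
Proof. by rewrite dotpDl -scaleN1r dotpZl mulN1r. Qed.

Lemma dotp0l x : dotp 0 x = 0.
Proof. by apply: big1 => i _; rewrite mxE mul0r. Qed.

Lemma dotp_delta u i : dotp u (delta_mx i 0) = u i 0.
Proof.
rewrite /dotp (bigD1 i)//= mxE !eqxx mulr1 big1 ?addr0// => k ki.
by rewrite mxE (negbTE ki) mulr0.
Qed.

Lemma continuous_dotp u : continuous (dotp u).
Proof.
apply: continuous_big => [|i _ x]; first exact: add_continuous.
have xi := @coord_continuous _ _ _ i 0 x.
exact: (@cvgM _ _ (nbhs x) _ (cst _) _ _ _ (cvg_cst _) xi).
Qed.

Lemma dotp_neq0 u : u != 0 -> exists w, dotp u w != 0.
Proof.
move=> u0; have [i ui] : exists i, u i 0 != 0.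
  apply/not_existsP => u00; move/eqP: u0; apply; apply/matrixP => i k.
  by rewrite ord1 mxE; apply/eqP; move/negP: (u00 i); rewrite negbK.
by exists (delta_mx i 0); rewrite dotp_delta.
Qed.

(** The form is affine in the parameter of the line and not identically zero,
so it has at most one root; excluding t = 0 itself covers the case where that
root is 0. *)
Lemma near_line_dotp_neq0 u x v : dotp u x != 0 \/ dotp u v != 0 ->
  \forall t \near (0 : R)^', dotp u (t *: v + x) != 0.
Proof.
have E t : dotp u (t *: v + x) = t * dotp u v + dotp u x.
  by rewrite dotpDr dotpZr.
have [vE|v0] := eqVneq (dotp u v) 0.
  by case=> [x0|//]; near=> t; rewrite E vE mulr0 add0r.
move=> _; have [xE|x0] := eqVneq (dotp u x) 0.
  by near=> t; rewrite E xE addr0 mulf_neq0//; near: t; exact: nbhs_dnbhs_neq.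
(* The only root; it is away from 0. *)
pose r := - (dotp u x / dotp u v).
have r0 : (0 : R) != r by rewrite eq_sym oppr_eq0 mulf_neq0// invr_eq0.
have nr : \forall t \near (0 : R)^', t != r.
  apply: nbhs_dnbhs; exact: (open_nbhs_nbhs (conj (@open_neq R r) r0)).
near=> t; rewrite E; apply: contra_neq (near nr t _) => [e|]; last by [].
by apply: (mulIf v0); rewrite /r mulNr divfK//; apply/eqP; rewrite -addr_eq0 e.
Unshelve. all: by end_near. Qed.

Lemma near_line_avoid (us : seq 'cV[R]_n) x v :
  {in us, forall u, dotp u x != 0 \/ dotp u v != 0} ->
  \forall t \near (0 : R)^', {in us, forall u, dotp u (t *: v + x) != 0}.
Proof.
elim: us => [|u us IH] us0; first by near=> t.
have /IH : {in us, forall z, dotp z x != 0 \/ dotp z v != 0}.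
  by move=> z zus; apply: us0; rewrite inE zus orbT.
apply: filterS2 (near_line_dotp_neq0 (us0 u (mem_head u us))) => t ut ust z.
by rewrite inE => /predU1P[->//|]; exact: ust.
Unshelve. all: by end_near. Qed.

(** A vector good for the tail is perturbed slightly in a direction w that is
good for the head: small perturbations keep the tail nonzero. *)
Lemma avoid_hyperplanes (us : seq 'cV[R]_n) : {in us, forall u, u != 0} ->
  exists v, {in us, forall u, dotp u v != 0}.
Proof.
elim: us => [|u us IH] us0; first by exists 0.
have [|v vP] := IH; first by move=> w wus; apply: us0; rewrite inE wus orbT.
have [w uw] := dotp_neq0 (us0 _ (mem_head u us)).
have : {in u :: us, forall z, dotp z v != 0 \/ dotp z w != 0}.
  by move=> z; rewrite inE => /predU1P[->|/vP]; [right|left].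
by move=> /near_line_avoid/filter_ex[t tP]; exists (t *: w + v).
Qed.

End DotProduct.

(** * Directional and logarithmic derivatives *)

Section Derivatives.
Variables (R : realType) (n : nat).
Implicit Types (x v g : 'cV[R]_n) (F G : 'cV[R]_n -> R).

(** Reduces directional derivatives to derivatives of functions of one real
variable; this is how the one-variable chain rule carries over. *)
Lemma is_derive_line F x v d :
  is_derive x v F d <-> is_derive (0 : R) 1 (fun t => F (t *: v + x)) d.
Proof.
have E : (fun h : R => h^-1 *: ((F \o shift x) (h *: v) - F x)) =
   (fun h : R => h^-1 *: (((fun t : R => F (t *: v + x)) \o shift (0 : R))
      (h *: (1 : R)) - F ((0 : R) *: v + x))).
  apply/funext => h /=.
  by rewrite addr0 scale0r add0r /GRing.scale/= mulr1.
by split=> -[]; rewrite /derivable /derive ?E => dF vF; apply: DeriveDef;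
  rewrite /derivable /derive ?E.
Qed.

Lemma is_derive_dotp (u : 'cV[R]_n) x v : is_derive x v (dotp u) (dotp u v).
Proof.
apply/is_derive_line.
have -> : (fun t : R => dotp u (t *: v + x)) =
    ((dotp u v) \*: (@idfun R)) + cst (dotp u x).
  by apply/funext => t /=; rewrite dotpDr dotpZr mulrC.
by apply: is_derive_eq; rewrite addr0 /GRing.scale/= mulr1.
Qed.

Lemma is_derive_comp (f : R -> R) F x v c d :
  is_derive (F x) 1 f c -> is_derive x v F d -> is_derive x v (f \o F) (c * d).
Proof.
move=> fc /is_derive_line Fd; apply/is_derive_line.
by apply: is_derive1_comp; rewrite scale0r add0r.
Qed.

(** Off 0, [rpow] is locally a constant sign times a power of |b|, so the usual
formula holds for negative bases too, for every exponent. *)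
Lemma is_derive_rpow (b e : R) : b != 0 ->
  is_derive b 1 (fun y => rpow y e) (rpow b e * (e / b)).
Proof.
have pos (c : R) : 0 < c -> c `^ e * (e / c) = e * c `^ (e - 1).
  by move=> c0; rewrite powRB ?(gt_eqF c0) ?implybT// powRr1 ?ltW//; ring.
case: ltgtP => // [b0|b0] _.
- have nb0 : 0 < - b by rewrite oppr_gt0.
  pose k : R := if `[< frac_odd_odd e >] then -1 else 1.
  have rE (y : R) : y < 0 -> rpow y e = k * (- y) `^ e.
    by move=> y0; rewrite /rpow y0/= ltr0_norm// /k; case: ifP => _;
      rewrite ?mulN1r ?mul1r.
  have -> : rpow b e * (e / b) = k *: ((e * (- b) `^ (e - 1)) * -1).
    by rewrite rE// -pos// /GRing.scale/= invrN; ring.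
  apply: (@near_eq_is_derive _ _ _ (k \*: ((@powR R ^~ e) \o -%R))).
    by near=> y => /=; rewrite rE//; near: y; exact: lt_nbhsl.
  apply: is_deriveZ; apply: is_derive1_comp; exact: is_derive1_powR.
- have rE (y : R) : 0 < y -> rpow y e = y `^ e.
    by move=> y0; rewrite /rpow ltNge ltW//= gtr0_norm.
  rewrite rE// pos//; apply: (@near_eq_is_derive _ _ _ (@powR R ^~ e)).
    by near=> y; rewrite rE//; near: y; exact: lt_nbhsr.
  exact: is_derive1_powR.
Unshelve. all: by end_near. Qed.

(** When F x is nonzero, g is the gradient of ln |F| at x and d is its pairing
with y. Asking for one g that serves all directions v, and not only for the
derivative along y, matters because the operators p_j are sums of partial
derivatives: linearity in v turns such a sum into a derivative along one
vector. *)
Definition log_derivative F x y d : Prop :=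
  exists2 g, forall v, is_derive x v F (F x * dotp g v) & dotp g y = d.

Lemma log_derivativeM F G x y c d :
  log_derivative F x y c -> log_derivative G x y d ->
  log_derivative (fun z => F z * G z) x y (c + d).
Proof.
move=> [f Ff <-] [g Gg <-]; exists (f + g); last by rewrite dotpDl.
move=> v; apply: (is_derive_eq (is_deriveM (Ff v) (Gg v))).
by rewrite dotpDl /GRing.scale/=; ring.
Qed.

Lemma log_derivative_prod (I : eqType) (r : seq I) (F : I -> 'cV[R]_n -> R) x y
    (d : I -> R) :
  (forall i, i \in r -> log_derivative (F i) x y (d i)) ->
  log_derivative (fun z => \prod_(i <- r) F i z) x y (\sum_(i <- r) d i).
Proof.
elim: r => [|i r IH] Fd.
  under eq_fun do rewrite big_nil.
  rewrite big_nil; exists 0; last exact: dotp0l.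
  by move=> v; rewrite dotp0l mulr0; exact: is_derive_cst.
under eq_fun do rewrite big_cons.
rewrite big_cons; apply: log_derivativeM; first exact/Fd/mem_head.
by apply: IH => k kr; apply: Fd; rewrite inE kr orbT.
Qed.

Lemma log_derivative_rpow F x y d (e : R) : F x != 0 ->
  log_derivative F x y d -> log_derivative (fun z => rpow (F z) e) x y (e * d).
Proof.
move=> F0 [g Fg <-]; exists (e *: g); last by rewrite dotpZl.
move=> v.
apply: (is_derive_eq (is_derive_comp (is_derive_rpow e F0) (Fg v))).
by rewrite dotpZl; field.
Qed.

Lemma log_derivative_expR F x y g (c : R) :
  (forall v, is_derive x v F (dotp g v)) ->
  log_derivative (fun z => expR (c * F z)) x y (c * dotp g y).
Proof.
move=> Fg; exists (c *: g); last by rewrite dotpZl.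
move=> v; have dcF : is_derive x v (c \*: F) (c * dotp g v).
  exact: is_deriveZ.
apply: (is_derive_eq (is_derive_comp (is_derive_expR _) dcF)).
by rewrite dotpZl.
Qed.

Lemma log_derivative_dotp (u : 'cV[R]_n) x y : dotp u x != 0 ->
  log_derivative (dotp u) x y (dotp u y / dotp u x).
Proof.
move=> u0; exists ((dotp u x)^-1 *: u); last by rewrite dotpZl mulrC.
by move=> v; rewrite dotpZl mulVKf//; exact: is_derive_dotp.
Qed.

End Derivatives.

(** * The modulus and the argument of a complex linear form *)

Section ModulusArgument.
Variables (R : realType) (n : nat) (nu : nat -> 'cV[R[i]]_n) (k : nat).
Implicit Types x y v : 'cV[R]_n.
Local Notation re := (dotp (vRe (nu k))).
Local Notation im := (dotp (vIm (nu k))).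

Lemma P_gt0 x : phi_defined nu k x -> 0 < P nu k x.
Proof. by move=> ux; rewrite ltr_wpDr ?sqr_ge0// exprn_even_gt0. Qed.

(** Here and below the two equations say that the derivative of the complex
form w along y is (a + i b) w x. Then ln P = 2 Re (ln w) has derivative
2 Re (a + i b). *)
Lemma log_derivative_P x y a b : phi_defined nu k x ->
  re y = a * re x - b * im x -> im y = b * re x + a * im x ->
  log_derivative (P nu k) x y (2 * a).
Proof.
move=> /P_gt0/lt0r_neq0 Px rey imy.
exists ((2 / P nu k x) *: (re x *: vRe (nu k) + im x *: vIm (nu k))).
  move=> v; have re2 := is_deriveX 2 (is_derive_dotp (vRe (nu k)) x v).
  have im2 := is_deriveX 2 (is_derive_dotp (vIm (nu k)) x v).
  apply: (is_derive_eq (is_deriveD re2 im2)).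
  by rewrite dotpZl dotpDl !dotpZl /GRing.scale/= !expr1; field.
by rewrite dotpZl dotpDl !dotpZl rey imy; move: Px; rewrite /P => Px; field.
Qed.

(** The differential of the argument of w = u + i v is
(u dv - v du) / (u^2 + v^2). *)
Lemma is_derive_phi x v : phi_defined nu k x ->
  is_derive x v (phi nu k)
    (dotp ((P nu k x)^-1 *: (re x *: vIm (nu k) - im x *: vRe (nu k))) v).
Proof.
move=> ux; have Px := lt0r_neq0 (P_gt0 ux).
have dre := is_derive_dotp (vRe (nu k)) x v.
have dim := is_derive_dotp (vIm (nu k)) x v.
have dV := is_derive_comp (@is_deriveV _ id _ _ _ ux (is_derive_id _ _)) dre.
apply: (is_derive_eq (is_derive_comp (is_derive1_atan _) (is_deriveM dim dV))).
rewrite dotpZl dotpBl !dotpZl /GRing.scale/=.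
rewrite -[(im * _) x]/(im x / re x).
by move: Px ux; rewrite /phi_defined /P => Px ux; field; rewrite Px.
Qed.

(** The logarithm of the function is p ln P + q phi, where ln P contributes
2 Re (a + i b) and the argument phi contributes Im (a + i b). *)
Lemma log_derivative_modulus_argument x y a b (p q : R) : phi_defined nu k x ->
  re y = a * re x - b * im x -> im y = b * re x + a * im x ->
  log_derivative (fun z => rpow (P nu k z) p * expR (q * phi nu k z)) x y
    (p * (2 * a) + q * b).
Proof.
move=> ux rey imy; have Px := lt0r_neq0 (P_gt0 ux).
apply: log_derivativeM.
  by apply: log_derivative_rpow => //; exact: log_derivative_P rey imy.
have -> : b = dotp ((P nu k x)^-1 *: (re x *: vIm (nu k) - im x *: vRe (nu k))) y.
  rewrite dotpZl dotpBl !dotpZl rey imy.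
  by move: Px; rewrite /P => Px; field.
by apply: log_derivative_expR => v; exact: is_derive_phi.
Qed.

End ModulusArgument.

(** * The operators p_j of the linear system *)

Lemma Re_mul (R : rcfType) (z w : R[i]) : complex.Re (z * w) =
  complex.Re z * complex.Re w - complex.Im z * complex.Im w.
Proof. by case: z w => [? ?] [? ?]. Qed.

Lemma Im_mul (R : rcfType) (z w : R[i]) : complex.Im (z * w) =
  complex.Re z * complex.Im w + complex.Im z * complex.Re w.
Proof. by case: z w => [? ?] [? ?]. Qed.

Section LinearSystem.
Variables (R : realType) (n m : nat) (a : 'I_n -> 'I_m -> 'I_n -> R).
Implicit Types (x : 'cV[R]_n) (F : 'cV[R]_n -> R).

(** p_j is the derivative along the j-th column of A(x). *)
Lemma fp_log_derivative j F x d :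
  log_derivative F x (col j (sysA a x)) d -> fp a j F x = F x * d.
Proof.
move=> [g Fg <-]; rewrite /fp mulr_sumr; apply: eq_bigr => i _.
rewrite /partial (@derive_val _ _ _ _ _ _ _ (Fg _)) dotp_delta.
by rewrite [col _ _ _ _]mxE; ring.
Qed.

Lemma continuous_fp j F x : C1_at F x -> {for x, continuous (fp a j F)}.
Proof.
move=> F1; have sysA_cont i : {for x, continuous (fun y => sysA a y i j)}.
  have -> : (fun y => sysA a y i j) = dotp (\col_xi a i j xi).
    by apply/funext => y; rewrite mxE; apply: eq_bigr => xi _; rewrite mxE.
  exact: continuous_dotp.
apply: (@cvg_big _ _ +%R 0 xpredT _ _ (nbhs x)) => [|i _].
  exact: add_continuous.
exact: cvgM (sysA_cont i) (F1 i).2.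
Qed.

(** The system reads dx = sum_j A_j^T x dt_j, and transposing moves A_j to the
other side of the pairing. *)
Lemma dotp_sysA (v : 'cV[R]_n) j x :
  dotp v (col j (sysA a x)) = dotp (Amx a j *m v) x.
Proof.
rewrite /dotp; under eq_bigr do rewrite !mxE mulr_sumr.
rewrite exchange_big; apply: eq_bigr => xi _; rewrite mxE mulr_suml.
by apply: eq_bigr => i _; rewrite !mxE; ring.
Qed.

(** Real and imaginary parts of p_j w = l_j w, for w the complex linear form
with coefficients v. *)
Lemma dotp_eigenvector (v : 'cV[R[i]]_n) (l : 'I_m -> R[i]) j x :
  common_eigenvector_of a v l ->
  dotp (vRe v) (col j (sysA a x)) =
    complex.Re (l j) * dotp (vRe v) x - complex.Im (l j) * dotp (vIm v) x /\
  dotp (vIm v) (col j (sysA a x)) =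
    complex.Im (l j) * dotp (vRe v) x + complex.Re (l j) * dotp (vIm v) x.
Proof.
move=> [_ /(_ j) E]; rewrite !dotp_sysA -!dotpZl -dotpBl -dotpDl.
split; congr (dotp _ x); apply/matrixP => i k; rewrite ord1.
  move/matrixP/(_ i 0)/(congr1 (@complex.Re R)): E.
  rewrite !mxE raddf_sum/= Re_mul => <-; apply: eq_bigr => xi _.
  by rewrite !mxE Re_mul/= mul0r subr0.
move/matrixP/(_ i 0)/(congr1 (@complex.Im R)): E.
rewrite !mxE raddf_sum/= Im_mul addrC => <-; apply: eq_bigr => xi _.
by rewrite !mxE Im_mul/= mul0r addr0.
Qed.

End LinearSystem.

(** * The first integrals *)

(** Groups the indices as the factors of F_1 and F_2 do: the pairs k and s + k,
then 2s + 1, then the real forms. *)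
Lemma sum_paired (V : zmodType) (f : nat -> V) (s m : nat) : (2 * s <= m)%N ->
  \sum_(1 <= k < m.+2) f k = \sum_(1 <= k < s.+1) (f k + f (s + k)%N)
    + f (2 * s).+1 + \sum_((2 * s).+2 <= k < m.+2) f k.
Proof.
move=> sm; rewrite (big_cat_nat (n := (2 * s).+2))//= big_nat_recr//=.
rewrite (big_cat_nat (n := s.+1))//= ?ltnS ?leq_pmull// big_split/=.
congr (_ + _ + _ + _).
rewrite -{1}[s.+1]addn1 addnC big_addn mul2n -addnn subSn ?leq_addr// addnK.
by apply: eq_bigr => k _; rewrite addnC.
Qed.

Lemma vRe_real_neq0 (R : realType) (n : nat) (v : 'cV[R[i]]_n) :
  v != 0 -> vIm v = 0 -> vRe v != 0.
Proof.
move=> v0 /matrixP im0; apply: contra_neq v0 => /matrixP re0.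
apply/matrixP => i k; move: (re0 i k) (im0 i k); rewrite !mxE.
by case: (v i k) => [? ?] /= -> ->.
Qed.

Section FirstIntegral.
Variables (R : realType) (n m s : nat) (a : 'I_n -> 'I_m -> 'I_n -> R).
Variables (nu : nat -> 'cV[R[i]]_n) (lam : nat -> 'I_m -> R[i]).
Variable h : nat -> R[i].
Hypothesis sm : (2 * s <= m)%N.
Hypothesis eig : forall k, (1 <= k <= m.+1)%N ->
  common_eigenvector_of a (nu k) (lam k).
Hypothesis lam_conj : forall k, (1 <= k <= s)%N ->
  forall j, lam (s + k)%N j = conjc (lam k j).
Hypothesis nu_real : forall k, ((2 * s).+2 <= k <= m.+1)%N -> vIm (nu k) = 0.
Hypothesis lam_h : forall j, \sum_(1 <= k < m.+2) lam k j * h k = 0.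

(** Each factor has an explicit logarithmic derivative, and these add up to
2 Re (sum_k lambda_k^j h_k) once the conjugate pairs are put together. *)
Lemma fp_F1_eq0_generic j x :
  (forall k, (1 <= k <= s)%N -> phi_defined nu k x) ->
  phi_defined nu (2 * s).+1 x ->
  (forall k, ((2 * s).+2 <= k <= m.+1)%N -> dotp (vRe (nu k)) x != 0) ->
  fp a j (F1 m s nu h) x = 0.
Proof.
move=> phik phi0 re0; pose y := col j (sysA a x).
have modarg k (p q : R) : (1 <= k <= m.+1)%N -> phi_defined nu k x ->
    log_derivative (fun z => rpow (P nu k z) p * expR (q * phi nu k z)) x y
      (p * (2 * complex.Re (lam k j)) + q * complex.Im (lam k j)).
  move=> /eig/(dotp_eigenvector j x)[rey imy] phix.
  exact: log_derivative_modulus_argument rey imy.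
have lin k (p : R) : ((2 * s).+2 <= k <= m.+1)%N ->
    log_derivative (fun z => rpow (dotp (vRe (nu k)) z) p) x y
      (p * complex.Re (lam k j)).
  move=> kI; have k1 : (1 <= k <= m.+1)%N by lia.
  have [rey _] := dotp_eigenvector j x (eig k1).
  have kx := re0 _ kI; apply: log_derivative_rpow => //.
  have -> : complex.Re (lam k j) = dotp (vRe (nu k)) y / dotp (vRe (nu k)) x.
    by rewrite rey nu_real// dotp0l mulr0 subr0 mulfK.
  exact: log_derivative_dotp.
(* p_j w = lambda w with w and p_j w real and w nonzero. *)
have lam_real k : ((2 * s).+2 <= k <= m.+1)%N -> complex.Im (lam k j) = 0.
  move=> kI; have k1 : (1 <= k <= m.+1)%N by lia.
  have [_] := dotp_eigenvector j x (eig k1).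
  rewrite nu_real// !dotp0l mulr0 addr0 => /esym/eqP.
  by rewrite mulf_eq0 (negbTE (re0 _ kI)) orbF => /eqP.
rewrite (@fp_log_derivative _ _ _ a j _ x
  (2 * complex.Re (\sum_(1 <= k < m.+2) lam k j * h k))).
  by rewrite lam_h !mulr0.
rewrite raddf_sum (sum_paired _ sm) !mulrDr !mulr_sumr.
apply: log_derivativeM; first apply: log_derivativeM.
- apply: log_derivative_prod => k; rewrite mem_index_iota ltnS => kI.
  have -> : 2 * (complex.Re (lam k j * h k)
        + complex.Re (lam (s + k)%N j * h (s + k)%N)) =
      (complex.Re (h k) + complex.Re (h (s + k)%N)) * (2 * complex.Re (lam k j))
      + - 2 * (complex.Im (h k) - complex.Im (h (s + k)%N))
        * complex.Im (lam k j).
    rewrite !Re_mul lam_conj//; case: (lam k j) => [p q] /=; ring.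
  by apply: modarg; [lia|exact: phik].
- rewrite /= Re_mul.
  have -> : 2 * (complex.Re (lam (2 * s).+1 j) * complex.Re (h (2 * s).+1)
        - complex.Im (lam (2 * s).+1 j) * complex.Im (h (2 * s).+1)) =
      complex.Re (h (2 * s).+1) * (2 * complex.Re (lam (2 * s).+1 j))
      + - 2 * complex.Im (h (2 * s).+1) * complex.Im (lam (2 * s).+1 j).
    ring.
  by apply: modarg; [lia|exact: phi0].
- apply: log_derivative_prod => k; rewrite mem_index_iota ltnS => kI.
  rewrite /= Re_mul lam_real// mul0r subr0.
  have -> : 2 * (complex.Re (lam k j) * complex.Re (h k)) =
    2 * complex.Re (h k) * complex.Re (lam k j) by ring.
  exact: lin.
Qed.

(** Extends the generic case to the hyperplanes where some real form vanishes,
by approaching x along a line that leaves all of them at once. *)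
Lemma fp_F1_eq0 j x : C1_domain (F1_defined m s nu h) (F1 m s nu h) x ->
  fp a j (F1 m s nu h) x = 0.
Proof.
move=> xD; have [_ C1x] := nbhs_singleton xD.
pose us := [seq vRe (nu k) | k <- index_iota (2 * s).+2 m.+2].
have [v vP] : exists v, {in us, forall u, dotp u v != 0}.
  apply: avoid_hyperplanes => u /mapP[k]; rewrite mem_index_iota => kI ->.
  by apply: vRe_real_neq0; [apply: (eig _).1; lia|exact: nu_real].
have line_cvg : (t *: v + x) @[t --> (0 : R)^'] --> x.
  rewrite -[in X in _ --> X](add0r x) -(scale0r v).
  apply: cvgD; last exact: cvg_cst.
  by apply: cvgZ; [exact: nbhs_dnbhs|exact: cvg_cst].
have fp_cvg : fp a j (F1 m s nu h) (t *: v + x) @[t --> (0 : R)^'] -->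
    fp a j (F1 m s nu h) x.
  exact: cvg_comp line_cvg (continuous_fp (a := a) (j := j) C1x).
apply: (cvg_unique _ fp_cvg) => //.
apply: cvg_near_cst; near=> t.
have [[phik phi0 _] _] : (F1_defined m s nu h `&` C1_at (F1 m s nu h))
    (t *: v + x) by near: t; exact: line_cvg xD.
apply: fp_F1_eq0_generic => [k /phik[]//||k kI]; first by case: phi0.
have : {in us, forall u, dotp u (t *: v + x) != 0}.
  by near: t; apply: near_line_avoid => u /vP; right.
by apply; apply/mapP; exists k; rewrite ?mem_index_iota.
Unshelve. all: by end_near. Qed.

End FirstIntegral.

(** Re (-i z) = Im z and Im (-i z) = - Re z, which exchanges the roles of the
real and imaginary parts of h exactly as F_2 does with respect to F_1. *)
Lemma F1_mulNi (R : realType) (n m s : nat) (nu : nat -> 'cV[R[i]]_n)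
    (h : nat -> R[i]) :
  F1 m s nu (fun k => - 'i%C * h k) = F2 m s nu h
  /\ F1_defined m s nu (fun k => - 'i%C * h k) = F2_defined m s nu h.
Proof.
have Re_mulNi (z : R[i]) : complex.Re (- 'i%C * z) = complex.Im z.
  by case: z => [p q] /=; ring.
have Im_mulNi (z : R[i]) : complex.Im (- 'i%C * z) = - complex.Re z.
  by case: z => [p q] /=; ring.
split.
  apply/funext => x; rewrite /F1 /F2 !Re_mulNi !Im_mulNi mulrNN.
  congr (_ * _ * _); last by under eq_bigr do rewrite Re_mulNi.
  apply: eq_bigr => k _; rewrite !Re_mulNi !Im_mulNi; congr (_ * expR (_ * _)).
  by ring.
rewrite /F1_defined /F2_defined.
by apply/seteqP; split=> x [c1 c2 c3]; split;
  [move=> k /c1 | move: c2 | move=> k /c3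
  |move=> k /c1 | move: c2 | move=> k /c3]; rewrite !Re_mulNi.
Qed.

Theorem theorem2p3 (R : realType) (n m s : nat)
  (a : 'I_n -> 'I_m -> 'I_n -> R)
  (nu : nat -> 'cV[R[i]]_n) (lam : nat -> 'I_m -> R[i]) (h : nat -> R[i]) :
  completely_solvable a ->
  (2 * s <= m)%N ->
  (forall k, (1 <= k <= m.+1)%N -> common_eigenvector_of a (nu k) (lam k)) ->
  (forall tau, (1 <= tau <= s)%N ->
     nu (s + tau)%N = map_mx (@conjc R) (nu tau)
     /\ forall j, lam (s + tau)%N j = conjc (lam tau j)) ->
  (forall theta, ((2 * s).+2 <= theta <= m.+1)%N -> vIm (nu theta) = 0) ->
  (exists k, (1 <= k <= m.+1)%N /\ h k != 0) ->
  (forall j, \sum_(1 <= k < m.+2) lam k j * h k = 0) ->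
  forall X : set 'cV[R]_n,
    is_domain X ->
    X `<=` C1_domain (F1_defined m s nu h) (F1 m s nu h)
        `&` C1_domain (F2_defined m s nu h) (F2 m s nu h) ->
    first_integral a X (F1 m s nu h) /\ first_integral a X (F2 m s nu h).
Proof.
move=> _ sm eig conj_pair nu_real _ lam_h X X_domain X_sub.
have lam_conj k : (1 <= k <= s)%N -> forall j, lam (s + k)%N j = conjc (lam k j).
  by move=> /conj_pair[].
have lam_h' j : \sum_(1 <= k < m.+2) lam k j * (- 'i%C * h k) = 0.
  by under eq_bigr do rewrite mulrCA; rewrite -mulr_sumr lam_h mulr0.
have [F2E F2dE] := F1_mulNi m s nu h.
split; split=> // [x /X_sub[D1 D2] | j x /X_sub[D1 D2]].
- by have [] := nbhs_singleton D1.
- exact: fp_F1_eq0 sm eig lam_conj nu_real lam_h j x D1.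
- by have [] := nbhs_singleton D2.
- rewrite -F2E; apply: (fp_F1_eq0 sm eig lam_conj nu_real lam_h').
  by rewrite F2E F2dE.
Qed.
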